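(* Let $E=(E^0,E^1,r,s)$ be a countable directed graph, let $(X,\mu,F)$ be a nonsingular $E$-branching system with induced representation $\pi:C^*(E)\to B(L^2(X,\mu))$ and Perron-Frobenius operator $P_F\in B(L^1(X,\mu))$, and let $\varphi\in L^2(X,\mu)$ (complex valued in general). 1. If $e_1,\dots,e_N$ are distinct edges of $E$ and $\mathrm{supp}(\varphi)\subseteq\bigcup_{j=1}^N R_{e_j}$, then $P_F(\varphi^2)=\sum_{j=1}^N\left(\pi(S_{e_j}^* )\varphi\right)^2$. 2. If $(e_j)_{j\ge1}$ is a sequence of distinct edges of $E$, $\varphi$ is real valued, and $\mathrm{supp}(\varphi)\subseteq\bigcup_{j=1}^\infty R_{e_j}$, then $$P_F(\varphi^2)=\lim_{N\to\infty}\sum_{j=1}^N\left(\pi(S_{e_j}^* )\varphi\right)^2,$$ where the convergence occurs in the norm of $L^1(X,\mu)$. 3. If $(e_j)_{j\ge1}$ is a sequence of distinct edges of $E$, $\mathrm{supp}(\varphi)\subseteq\bigcup_{j=1}^\infty R_{e_j}$, and $\varphi=u+\mathrm{i}v$ with $u,v$ real functions such that $uv\in L^2(X,\mu)$, then $$P_F(\varphi^2)=\lim_{N\to\infty}\sum_{j=1}^N\left(\pi(S_{e_j}^* )\varphi\right)^2,$$ where the convergence occurs in the norm of $L^1(X,\mu)$.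
   Context: A directed graph $E=(E^0,E^1,r,s)$ consists of a set $E^0$ of vertices, a set $E^1$ of edges, and range and source maps $r,s:E^1\to E^0$; it is countable if $E^0$ and $E^1$ are finite or countably infinite. The graph C*-algebra $C^*(E)$ is the universal C*-algebra generated by mutually orthogonal projections $\{P_v\}_{v\in E^0}$ and partial isometries $\{S_e\}_{e\in E^1}$ with mutually orthogonal ranges such that: $S_e^*S_e=P_{r(e)}$ for each $e\in E^1$; $S_eS_e^*\le P_{s(e)}$ for each $e\in E^1$; and $P_v=\sum_{e:s(e)=v}S_eS_e^*$ for every vertex $v$ with $0<\#\{e\in E^1: s(e)=v\}<\infty$. For measurable sets $A,B$ in a measure space $(X,\mu)$, $B\stackrel{\mu-a.e.}{\subseteq}A$ means $\mu(B\setminus A)=0$, and $A\stackrel{\mu-a.e.}{=}B$ means $\mu(A\setminus B)=\mu(B\setminus A)=0$. For maps $f,g$ on $A$, $f\stackrel{\mu-a.e.}{=}g$ means $\mu(\{x\in A: f(x)\ne g(x)\})=0$. An $E$-branching system is a measure space $(X,\mu)$ with families of measurable subsets $\{R_e\}_{e\in E^1}$, $\{D_v\}_{v\in E^0}$ of $X$, and maps $f_e,f_e^{-1},\Phi_{f_e},\Phi_{f_e^{-1}}$ ($e\in E^1$), such that: 1. $R_e\cap R_d\stackrel{\mu-a.e.}{=}\emptyset$ for all $d\neq e$ in $E^1$; 2. $D_u\cap D_v\stackrel{\mu-a.e.}{=}\emptyset$ for all $u\ne v$ in $E^0$; 3. $R_e\stackrel{\mu-a.e.}{\subseteq}D_{s(e)}$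 for each $e\in E^1$; 4. $D_v\stackrel{\mu-a.e.}{=}\bigcup_{e:s(e)=v}R_e$ whenever $0<\#\{e\in E^1:s(e)=v\}<\infty$; 5. for each $e\in E^1$, $f_e:D_{r(e)}\to R_e$ is a measurable map with $f_e(D_{r(e)})\stackrel{\mu-a.e.}{=}R_e$, and the Radon-Nikodym derivative $\Phi_{f_e}$ of $\mu\circ f_e$ with respect to $\mu$ on $D_{r(e)}$ exists (that is, $\mu(f_e(A))=\int_A\Phi_{f_e}\,d\mu$ for all measurable $A\subseteq D_{r(e)}$) and $\Phi_{f_e}>0$ $\mu$-a.e. on $D_{r(e)}$; 6. for each $e\in E^1$, $f_e^{-1}:R_e\to D_{r(e)}$ is a measurable map with $f_e\circ f_e^{-1}\stackrel{\mu-a.e.}{=}\mathrm{Id}_{R_e}$ and $f_e^{-1}\circ f_e\stackrel{\mu-a.e.}{=}\mathrm{Id}_{D_{r(e)}}$, and the Radon-Nikodym derivative $\Phi_{f_e^{-1}}$ of $\mu\circ f_e^{-1}$ with respect to $\mu$ on $R_e$ exists (that is, $\mu(f_e^{-1}(B))=\int_B\Phi_{f_e^{-1}}\,d\mu$ for all measurable $B\subseteq R_e$). $\Phi_{f_e}$ and $\Phi_{f_e^{-1}}$ are nonnegative real-valued measurable functions, extended by $0$ to $X$. A map $F:X\to X$ is nonsingular if it is measurable and $\mu(F^{-1}(A))=0$ whenever $\mu(A)=0$. A nonsingular $E$-branching system $(X,\mu,F)$ is an $E$-branching system $(X,\mu)$ together with a nonsingular map $F:X\to X$ such that $F|_{R_e}\stackrel{\mu-a.e.}{=}f_e^{-1}$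 for each $e\in E^1$. The induced representation is the $*$-homomorphism $\pi:C^*(E)\to B(L^2(X,\mu))$ with $\pi(S_e)\phi=\chi_{R_e}\cdot\Phi_{f_e^{-1}}^{1/2}\cdot(\phi\circ f_e^{-1})$ and $\pi(P_v)\phi=\chi_{D_v}\phi$. Its adjoints are given by $\pi(S_e^* )\phi=\pi(S_e)^*\phi=\chi_{D_{r(e)}}\cdot\Phi_{f_e}^{1/2}\cdot(\phi\circ f_e)$. These products are understood as $0$ outside $R_e$, respectively outside $D_{r(e)}$. The Perron-Frobenius operator $P_F$ induced by $F$ is the operator in $B(L^1(X,\mu))$ such that, for all $\psi\in L^1(X,\mu)$ and all measurable $A\subseteq X$, $$\int_A P_F(\psi)\,d\mu=\int_{F^{-1}(A)}\psi\,d\mu.$$ $\mathrm{supp}(\varphi)\subseteq B$ means that $\varphi=0$ $\mu$-a.e. outside $B$. Squares such as $\varphi^2$ are pointwise squares (no absolute values), and equalities are in $L^1(X,\mu)$. *)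

(* Defs.v *)
From HB Require Import structures.
From mathcomp Require Import all_boot all_order all_algebra.
From mathcomp Require Export complex.
From mathcomp Require Import all_classical all_reals all_analysis.

Set Implicit Arguments.
Unset Strict Implicit.
Unset Printing Implicit Defensive.

Import Order.TTheory GRing.Theory Num.Theory.
Import numFieldNormedType.Exports.

Local Open Scope classical_set_scope.
Local Open Scope ring_scope.
Local Open Scope complex_scope.

Record digraph := Digraph {
  vertex : countType;
  edge : countType;
  range_of : edge -> vertex;
  source_of : edge -> vertex }.

Definition out_edges (E : digraph) (v : vertex E) : set (edge E) :=
  [set e | source_of e = v].

Definition regular_vertex (E : digraph) (v : vertex E) : Prop :=
  out_edges v !=set0 /\ finite_set (out_edges v).

(* C*-algebras are not assumed to be unital ([C*(E)] has no unit when the graph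
   has infinitely many vertices), so the product is not that of a ring of the
   algebraic hierarchy. The norm takes its values in [R[i]]. *)
Record cstar_algebra (R : realType) := CstarAlgebra {
  cstar_sort :> completeNormedModType R[i];
  cstar_mul : cstar_sort -> cstar_sort -> cstar_sort;
  star : cstar_sort -> cstar_sort;
  cstar_mulA : forall a b c, cstar_mul a (cstar_mul b c) = cstar_mul (cstar_mul a b) c;
  cstar_mulDl : forall a b c, cstar_mul (a + b) c = cstar_mul a c + cstar_mul b c;
  cstar_mulDr : forall a b c, cstar_mul a (b + c) = cstar_mul a b + cstar_mul a c;
  cstar_mulZl : forall (k : R[i]) a b, cstar_mul (k *: a) b = k *: cstar_mul a b;
  cstar_mulZr : forall (k : R[i]) a b, cstar_mul a (k *: b) = k *: cstar_mul a b;
  starK : forall a, star (star a) = a;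
  starD : forall a b, star (a + b) = star a + star b;
  starZ : forall (k : R[i]) a, star (k *: a) = k^*%C *: star a;
  starM : forall a b, star (cstar_mul a b) = cstar_mul (star b) (star a);
  cstar_normM : forall a b, `|cstar_mul a b| <= `|a| * `|b|;
  cstar_identity : forall a, `|cstar_mul (star a) a| = `|a| ^+ 2 }.

Declare Scope cstar_scope.
Delimit Scope cstar_scope with cstar.
Notation "a ** b" := (cstar_mul a b) (at level 40, left associativity) : cstar_scope.
Local Open Scope cstar_scope.

(* An element of a C*-algebra is positive when it is of the form [c^* c]. *)
Definition cstar_le (R : realType) (A : cstar_algebra R) (a b : A) : Prop :=
  exists c : A, b - a = star c ** c.

Definition projection (R : realType) (A : cstar_algebra R) (p : A) : Prop :=
  star p = p /\ p ** p = p.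

Definition partial_isometry (R : realType) (A : cstar_algebra R) (a : A) : Prop :=
  a ** star a ** a = a.

Record star_hom (R : realType) (A B : cstar_algebra R) (h : A -> B) : Prop := StarHom {
  star_homD : forall a b, h (a + b) = h a + h b;
  star_homZ : forall (k : R[i]) a, h (k *: a) = k *: h a;
  star_homM : forall a b, h (a ** b) = h a ** h b;
  star_homS : forall a, h (star a) = star (h a) }.

Record cuntz_krieger (R : realType) (E : digraph) (A : cstar_algebra R)
    (P : vertex E -> A) (S : edge E -> A) : Prop := CuntzKrieger {
  ck_projection : forall v, projection (P v);
  ck_vertex_orth : forall u v, u <> v -> P u ** P v = 0;
  ck_partial_isometry : forall e, partial_isometry (S e);
  ck_range_orth : forall d e, d <> e -> (S d ** star (S d)) ** (S e ** star (S e)) = 0;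
  ck_range : forall e, star (S e) ** S e = P (range_of e);
  ck_source : forall e, cstar_le (S e ** star (S e)) (P (source_of e));
  ck_regular : forall v, regular_vertex v ->
    P v = \sum_(e \in out_edges v) (S e ** star (S e)) }.

Record graph_cstar (R : realType) (E : digraph) (A : cstar_algebra R)
    (P : vertex E -> A) (S : edge E -> A) : Prop := GraphCstar {
  graph_cstar_ck : cuntz_krieger P S;
  graph_cstar_universal : forall (B : cstar_algebra R) (p : vertex E -> B) (s : edge E -> B),
    cuntz_krieger p s ->
    exists! h : A -> B, [/\ star_hom h, forall v, h (P v) = p v & forall e, h (S e) = s e] }.

(* Elements of Lp are represented by functions, and equality in Lp is equality
   almost everywhere; accordingly an operator on Lp is a map on functions, of
   which only the values on p-integrable functions, up to equality almost
   everywhere, are meaningful. *)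
Section Lp.
Context {d : measure_display} {X : measurableType d} {R : realType}.
Variable mu : {measure set X -> \bar R}.
Implicit Types f g : X -> R[i].

Definition cmeasurable f : Prop :=
  measurable_fun setT (fun x => complex.Re (f x)) /\
  measurable_fun setT (fun x => complex.Im (f x)).

Definition cLnorm (p : \bar R) f : \bar R :=
  Lnorm mu p (fun x => (ComplexField.Normc.normc (f x))%:E).

Definition memLp (p : \bar R) f : Prop := cmeasurable f /\ (cLnorm p f < +oo)%E.

Definition cintegral (A : set X) f : R[i] :=
  (\int[mu]_(x in A) complex.Re (f x)) +i* (\int[mu]_(x in A) complex.Im (f x)).

Definition inner f g : R[i] := cintegral setT (fun x => f x * (g x)^*%C).

Record bounded_operator (p : \bar R) (T : (X -> R[i]) -> (X -> R[i])) : Prop :=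
  BoundedOperator {
  bounded_operator_mem : forall f, memLp p f -> memLp p (T f);
  bounded_operator_ae : forall f g, memLp p f -> memLp p g ->
    f = g %[ae mu] -> T f = T g %[ae mu];
  bounded_operator_linear : forall (k : R[i]) f g, memLp p f -> memLp p g ->
    T (fun x => k * f x + g x) = (fun x => k * T f x + T g x) %[ae mu];
  bounded_operator_bound : exists M : R, forall f, memLp p f ->
    (cLnorm p (T f) <= M%:E * cLnorm p f)%E }.

(* A *-homomorphism from [A] to [B(L^2(X, mu))]: the last clause says that
   [pi (star a)] is the Hilbert space adjoint of [pi a]. *)
Record star_representation (A : cstar_algebra R)
    (pi : A -> (X -> R[i]) -> (X -> R[i])) : Prop := StarRepresentation {
  star_rep_bounded : forall a, bounded_operator 2%:E (pi a);
  star_repD : forall a b f, memLp 2%:E f ->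
    pi (a + b) f = (fun x => pi a f x + pi b f x) %[ae mu];
  star_repZ : forall (k : R[i]) a f, memLp 2%:E f ->
    pi (k *: a) f = (fun x => k * pi a f x) %[ae mu];
  star_repM : forall a b f, memLp 2%:E f ->
    pi (a ** b) f = pi a (pi b f) %[ae mu];
  star_repS : forall a f g, memLp 2%:E f -> memLp 2%:E g ->
    inner (pi (star a) f) g = inner f (pi a g) }.

(* The operator is determined up to equality almost everywhere. *)
Definition perron_frobenius (F : X -> X) (PF : (X -> R[i]) -> (X -> R[i])) : Prop :=
  bounded_operator 1%:E PF /\
  forall psi, memLp 1%:E psi -> forall A, measurable A ->
    cintegral A (PF psi) = cintegral (F @^-1` A) psi.

Definition ae_support (f : X -> R[i]) (B : set X) : Prop :=
  \forall x \ae mu, ~ B x -> f x = 0.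

Definition ae_subset (B A : set X) : Prop := mu (B `\` A) = 0%E.

Definition ae_set_eq (A B : set X) : Prop := ae_subset A B /\ ae_subset B A.

Definition nonsingular (F : X -> X) : Prop :=
  measurable_fun setT F /\
  forall A, measurable A -> mu A = 0%E -> mu (F @^-1` A) = 0%E.

(* [Phi] is the Radon-Nikodym derivative of [mu \o f] with respect to [mu] on
   [D]. That [mu (f @` A)] makes sense, i.e., that [f @` A] is measurable, is
   part of the assertion. *)
Definition image_derivative (D : set X) (f : X -> X) (Phi : X -> R) : Prop :=
  [/\ measurable_fun setT Phi,
      forall x, 0 <= Phi x,
      forall x, ~ D x -> Phi x = 0 &
      forall A, measurable A -> A `<=` D ->
        measurable (f @` A) /\ mu (f @` A) = (\int[mu]_(x in A) (Phi x)%:E)%E].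

End Lp.

(* The maps [f_e : D_{r(e)} -> R_e] and [f_e^{-1} : R_e -> D_{r(e)}] are
   represented by total maps whose values off these domains are irrelevant. *)
Record branching_system (E : digraph) (d : measure_display) (X : measurableType d)
    (R : realType) (mu : {measure set X -> \bar R}) := BranchingSystem {
  bs_R : edge E -> set X;
  bs_D : vertex E -> set X;
  bs_f : edge E -> X -> X;
  bs_finv : edge E -> X -> X;
  bs_Phi : edge E -> X -> R;
  bs_Phiinv : edge E -> X -> R;
  bs_measurableR : forall e, measurable (bs_R e);
  bs_measurableD : forall v, measurable (bs_D v);
  bs_disjointR : forall c e, c <> e -> ae_set_eq mu (bs_R e `&` bs_R c) set0;
  bs_disjointD : forall u v, u <> v -> ae_set_eq mu (bs_D u `&` bs_D v) set0;
  bs_source : forall e, ae_subset mu (bs_R e) (bs_D (source_of e));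
  bs_regular : forall v, regular_vertex v ->
    ae_set_eq mu (bs_D v) (\bigcup_(e in out_edges v) bs_R e);
  bs_f_maps : forall e x, bs_D (range_of e) x -> bs_R e (bs_f e x);
  bs_f_measurable : forall e, measurable_fun (bs_D (range_of e)) (bs_f e);
  bs_f_onto : forall e, ae_set_eq mu (bs_f e @` bs_D (range_of e)) (bs_R e);
  bs_f_derivative : forall e,
    image_derivative mu (bs_D (range_of e)) (bs_f e) (bs_Phi e);
  bs_Phi_gt0 : forall e, \forall x \ae mu, bs_D (range_of e) x -> 0 < bs_Phi e x;
  bs_finv_maps : forall e x, bs_R e x -> bs_D (range_of e) (bs_finv e x);
  bs_finv_measurable : forall e, measurable_fun (bs_R e) (bs_finv e);
  bs_finvK : forall e, bs_f e \o bs_finv e = id %[ae mu in bs_R e];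
  bs_fK : forall e, bs_finv e \o bs_f e = id %[ae mu in bs_D (range_of e)];
  bs_finv_derivative : forall e,
    image_derivative mu (bs_R e) (bs_finv e) (bs_Phiinv e) }.

Definition nonsingular_branching_system (E : digraph) (d : measure_display)
    (X : measurableType d) (R : realType) (mu : {measure set X -> \bar R})
    (B : branching_system E mu) (F : X -> X) : Prop :=
  nonsingular mu F /\ forall e, F = bs_finv B e %[ae mu in bs_R B e].

(* The formula for [pi (star (S e))] is not part of the definition, because a
   *-homomorphism sends [star (S e)] to the adjoint of [pi (S e)]. *)
Definition induced_representation (E : digraph) (d : measure_display)
    (X : measurableType d) (R : realType) (mu : {measure set X -> \bar R})
    (B : branching_system E mu)
    (A : cstar_algebra R) (P : vertex E -> A) (S : edge E -> A)
    (pi : A -> (X -> R[i]) -> (X -> R[i])) : Prop :=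
  [/\ star_representation mu pi,
      forall e phi, memLp mu 2%:E phi ->
        pi (S e) phi = (fun x => (\1_(bs_R B e) x * Num.sqrt (bs_Phiinv B e x))%:C
                                 * phi (bs_finv B e x)) %[ae mu] &
      forall v phi, memLp mu 2%:E phi ->
        pi (P v) phi = (fun x => (\1_(bs_D B v) x)%:C * phi x) %[ae mu]].

(* Main.v *)
(* Write q = f_e^-1 and Psi = Phi_{f_e^-1}. Since q is nonsingular and onto, the
   integral over D_{r(e)} of a function h is that of (h o q) Psi over R_e, and
   Psi > 0 a.e. on R_e. Hence pi(S_e)^* phi, being characterized by the inner
   products of phi with the pi(S_e) w, is chi_D (Psi o f_e)^(-1/2) (phi o f_e);
   squaring and changing variables again, its square integrates over any A to
   the integral of chi_{R_e} phi^2 over F^-1(A), so it is P_F(chi_{R_e} phi^2).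
   The sets R_e are a.e. disjoint, so phi^2 is the sum of the chi_{R_{e_j}} phi^2.
   For an infinite sequence of edges this series converges in L^1 by dominated
   convergence, and P_F is bounded on L^1. *)
Require Import Defs.
From HB Require Import structures.
From mathcomp Require Import all_boot all_order all_algebra.
From mathcomp Require Import all_classical all_reals all_analysis.
From mathcomp Require Import measurable_realfun ring lra.

Set Implicit Arguments.
Unset Strict Implicit.
Unset Printing Implicit Defensive.

Import Order.TTheory GRing.Theory Num.Theory.
Import numFieldNormedType.Exports.
Local Open Scope classical_set_scope.
Local Open Scope ring_scope.
Local Open Scope complex_scope.

(** * Change of variables along an almost onto map [q] from [Q] to [D] with derivative [Psi] *)

Section change_of_variables.
Context {d : measure_display} {X : measurableType d} {R : realType}.
Variables (mu : {measure set X -> \bar R}) (D Q : set X) (q : X -> X) (Psi : X -> R).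
Hypotheses (mD : measurable D) (mQ : measurable Q) (mq : measurable_fun Q q).
Hypothesis qQ : forall x, Q x -> D (q x).
Hypothesis q_onto : \forall y \ae mu, D y -> (q @` Q) y.
Hypothesis dq : image_derivative mu Q q Psi.

Let mPsi : measurable_fun Q (fun x => (Psi x)%:E).
Proof.
by case: dq => mPsi _ _ _; apply/measurable_EFinP; exact: measurable_funTS.
Qed.

Let Psi_ge0 x : 0 <= Psi x. Proof. by case: dq. Qed.

(** The integral is the measure of the image under [q] of the part of [Q] lying over [A]. This image
    is contained in [A], and a point of [A] outside it is not in the range of [q] at all, so the
    difference is null by [q_onto]. *)
Lemma measure_image_derivative (A : set X) : measurable A -> A `<=` D ->
  mu A = (\int[mu]_(x in Q `&` q @^-1` A) (Psi x)%:E)%E.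
Proof.
move=> mA AD; have mqA : measurable (Q `&` q @^-1` A) by exact: mq.
case: dq => _ _ _ /(_ _ mqA (@subIsetl _ _ _))[mI <-].
have IA : q @` (Q `&` q @^-1` A) `<=` A by move=> _ [x [_ Ax] <-].
rewrite -[in LHS](setDUK IA) measureU//; last 2 first.
- exact: measurableD.
- by rewrite setDE setICA setICr setI0.
rewrite [X in (_ + X)%E](_ : _ = 0%E) ?adde0//.
have [N [mN N0 subN]] := q_onto.
apply: (subset_measure0 _ mN _ N0); first exact: measurableD.
move=> y [Ay nIy]; apply: subN => /= /(_ (AD _ Ay))[x Qx qxy].
by apply: nIy; exists x => //; split => //=; rewrite qxy.
Qed.

Import HBNNSimple.

(** Monotone convergence on both sides reduces the claim to simple functions, and additivity over
    level sets reduces it to indicators, which are the case of [measure_image_derivative]. *)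
Lemma ge0_integral_image_derivative (h : X -> \bar R) :
  measurable_fun D h -> (forall y, D y -> 0 <= h y)%E ->
  (\int[mu]_(y in D) h y = \int[mu]_(x in Q) (h (q x) * (Psi x)%:E))%E.
Proof.
move=> mh h0; pose h_ := nnsfun_approx mD mh.
have mh_q n : measurable_fun Q (fun x => (h_ n (q x))%:E).
  apply/measurable_EFinP.
  by apply: (measurable_comp measurableT) => //; exact: measurable_funP.
transitivity (limn (fun n => \int[mu]_(y in D) (h_ n y)%:E))%E.
  rewrite -monotone_convergence//.
  - apply: eq_integral => y /[!inE] yD; apply/esym/cvg_lim => //.
    exact: cvg_nnsfun_approx.
  - by move=> n; apply/measurable_EFinP; apply: measurable_funTS; exact: measurable_funP.
  - by move=> n y _; rewrite lee_fin.
  - by move=> y _ m n mn; rewrite lee_fin; exact/lefP/nd_nnsfun_approx.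
transitivity (limn (fun n => \int[mu]_(x in Q) ((h_ n (q x))%:E * (Psi x)%:E)))%E; last first.
  rewrite -monotone_convergence//.
  - apply: eq_integral => x /[!inE] xQ; apply/cvg_lim => //.
    apply: cvgeZr => //; apply: cvg_nnsfun_approx => //; exact: qQ.
  - by move=> n; exact: emeasurable_funM.
  - by move=> n y _; rewrite -EFinM lee_fin mulr_ge0.
  - move=> y _ m n mn; rewrite -!EFinM lee_fin ler_wpM2r//.
    exact/lefP/nd_nnsfun_approx.
congr (limn _); apply/funext => n.
have mS r : measurable (h_ n @^-1` [set r]) by exact: measurable_sfunP.
have mqS r : measurable (Q `&` q @^-1` (h_ n @^-1` [set r])) by exact: mq.
transitivity (\sum_(r \in range (h_ n))
   (\int[mu]_(y in D) (r * \1_(h_ n @^-1` [set r]) y)%:E))%E.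
  under eq_integral do rewrite fimfunE -fsumEFin//.
  rewrite ge0_integral_fsum//.
  - by move=> r; apply/measurable_EFinP; apply: measurable_funTS; exact: measurable_funM.
  - by move=> r y _; rewrite nnfun_muleindic_ge0.
transitivity (\sum_(r \in range (h_ n))
   (\int[mu]_(x in Q) ((r * \1_(h_ n @^-1` [set r]) (q x))%:E * (Psi x)%:E)))%E; last first.
  rewrite -ge0_integral_fsum//.
  - apply: eq_integral => x _; rewrite [in RHS]fimfunE -fsumEFin//.
    rewrite ge0_mule_fsuml// => r; exact: nnfun_muleindic_ge0.
  - move=> r; apply: emeasurable_funM => //; apply/measurable_EFinP.
    by apply: measurable_funM => //; apply: (measurable_comp measurableT).
  - by move=> r x _; rewrite mule_ge0 ?nnfun_muleindic_ge0// lee_fin.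
(* Only values actually taken by the simple function occur in the sum, so [r] is nonnegative and can
   be pulled out of both integrals. *)
apply: eq_fsbigr => _ /set_mem[z _ <-]; set r := h_ n z.
have r0 : 0 <= r by exact: fun_ge0.
under eq_integral do rewrite EFinM.
under [RHS]eq_integral do rewrite EFinM -muleA.
have mS1 : measurable_fun Q (fun x => (\1_(h_ n @^-1` [set r]) (q x) : R)%:E).
  by apply/measurable_EFinP; apply: (measurable_comp measurableT).
rewrite !ge0_integralZl//.
- congr (_ * _)%E; rewrite integral_indic//.
  rewrite measure_image_derivative; last 2 first.
  + exact: measurableI.
  + exact: subIsetr.
  rewrite (_ : Q `&` _ = Q `&` q @^-1` (h_ n @^-1` [set r])); last first.
    by apply/seteqP; split=> [x [Qx []]//|x [Qx Sx]]; split => //; split => //; exact: qQ.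
  rewrite integral_mkcondr; apply: eq_integral => x _.
  by rewrite epatch_indic muleC.
- exact: emeasurable_funM.
- by move=> x _; rewrite mule_ge0// lee_fin.
- by apply/measurable_EFinP; exact: measurable_funTS.
Qed.

(* As the Lebesgue integral is the difference of the integrals of the positive
   and negative parts, no integrability is required. *)
Lemma integral_image_derivative (h k : X -> R) :
  measurable_fun D h -> measurable_fun Q k ->
  (\forall x \ae mu, Q x -> h (q x) * Psi x = k x) ->
  (\int[mu]_(y in D) (h y)%:E = \int[mu]_(x in Q) (k x)%:E)%E.
Proof.
move=> mh mk hk.
have mhe : measurable_fun D (fun y => (h y)%:E) by exact/measurable_EFinP.
have mhq : measurable_fun Q (fun x => (h (q x) * Psi x)%:E).
  apply/measurable_EFinP; apply: measurable_funM; last exact/measurable_EFinP.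
  by apply: (measurable_comp mD) => // _ [x Qx <-]; exact: qQ.
transitivity (\int[mu]_(x in Q) (h (q x) * Psi x)%:E)%E; last first.
  apply: ae_eq_integral => //; first exact/measurable_EFinP.
  by apply: filterS hk => x hkx Qx; rewrite hkx.
(* Since [Psi] is nonnegative, multiplication by it commutes with taking positive and negative
   parts. *)
rewrite integralE [RHS]integralE; congr (_ - _)%E.
- rewrite ge0_integral_image_derivative//; last exact: measurable_funepos.
  apply: eq_integral => x _; rewrite !funeposE.
  by rewrite EFinM maxe_pMl ?mul0e// lee_fin.
- rewrite ge0_integral_image_derivative//; last exact: measurable_funeneg.
  apply: eq_integral => x _; rewrite !funenegE.
  by rewrite EFinM -mulNe maxe_pMl ?mul0e// lee_fin.
Qed.

End change_of_variables.

(** * Real and imaginary parts and modulus of complex numbers *)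

Section complex_numbers.
Context {R : rcfType}.
Implicit Types x y : R[i].
Local Notation normc := ComplexField.Normc.normc.

Lemma complexReM x y :
  complex.Re (x * y) = complex.Re x * complex.Re y - complex.Im x * complex.Im y.
Proof. by case: x y => [a b] [c e]. Qed.

Lemma complexImM x y :
  complex.Im (x * y) = complex.Re x * complex.Im y + complex.Im x * complex.Re y.
Proof. by case: x y => [a b] [c e]. Qed.

Lemma complexReZ (a : R) x : complex.Re (a%:C * x) = a * complex.Re x.
Proof. by rewrite complexReM/= mul0r subr0. Qed.

Lemma complexImZ (a : R) x : complex.Im (a%:C * x) = a * complex.Im x.
Proof. by rewrite complexImM/= mul0r addr0. Qed.

Lemma complexReJ x : complex.Re (x^*%C) = complex.Re x. Proof. by case: x. Qed.

Lemma complexImJ x : complex.Im (x^*%C) = - complex.Im x. Proof. by case: x. Qed.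

Lemma complexReZJ (a : R) x y :
  complex.Re (x * (a%:C * y)^*%C) = a * complex.Re (x * y^*%C).
Proof. by rewrite !complexReM !complexReJ !complexImJ complexReZ complexImZ; ring. Qed.

Lemma normcE x : normc x = Num.sqrt (complex.Re x ^+ 2 + complex.Im x ^+ 2).
Proof. by case: x. Qed.

Lemma normc_ge0 x : 0 <= normc x. Proof. by rewrite normcE sqrtr_ge0. Qed.

Lemma sqr_normcE x : normc x ^+ 2 = complex.Re x ^+ 2 + complex.Im x ^+ 2.
Proof. by rewrite normcE sqr_sqrtr// addr_ge0// sqr_ge0. Qed.

Lemma normcZ (a : R) x : normc (a%:C * x) = `|a| * normc x.
Proof. by rewrite ComplexField.Normc.normcM normcE/= expr0n addr0 sqrtr_sqr. Qed.

Lemma normcX x n : normc (x ^+ n) = normc x ^+ n.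
Proof.
elim: n => [|n IH]; first by rewrite !expr0 ComplexField.Normc.normc1.
by rewrite !exprS ComplexField.Normc.normcM IH.
Qed.

Lemma normc_Re_le x : `|complex.Re x| <= normc x.
Proof. by rewrite normcE -sqrtr_sqr ler_wsqrtr// lerDl sqr_ge0. Qed.

Lemma normc_Im_le x : `|complex.Im x| <= normc x.
Proof. by rewrite normcE -sqrtr_sqr ler_wsqrtr// lerDr sqr_ge0. Qed.

Lemma normr_ReMJ_le x y : `|complex.Re (x * y^*%C)| <= normc x ^+ 2 + normc y ^+ 2.
Proof.
rewrite (le_trans (normc_Re_le _))// ComplexField.Normc.normcM.
have -> : normc (y^*%C) = normc y by rewrite !normcE complexReJ complexImJ sqrrN.
rewrite -subr_ge0; have := sqr_ge0 (normc x - normc y).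
have := mulr_ge0 (normc_ge0 x) (normc_ge0 y).
move=> ? ?; nra.
Qed.

Lemma sqr_normcB_le x y : normc (x - y) ^+ 2 <= 2 * (normc x ^+ 2 + normc y ^+ 2).
Proof.
rewrite !sqr_normcE; case: x y => [a b] [c e] /=.
(* By the parallelogram law the difference of the two sides is the squared modulus of [x + y]. *)
have := sqr_ge0 (a + c); have := sqr_ge0 (b + e); move=> ? ?; nra.
Qed.

End complex_numbers.

(** Complex integrals are built from real ones, which are [fine] of extended integrals; this
    recovers equality of the latter when they are finite. *)
Lemma fin_num_fine_inj (R : numDomainType) (x y : \bar R) :
  x \is a fin_num -> y \is a fin_num -> fine x = fine y -> x = y.
Proof. by move=> xfin yfin xy; rewrite -(fineK xfin) xy fineK. Qed.

(** * Measurability, integrability and almost everywhere equality of complex functions *)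

Section complex_Lp.
Context {d : measure_display} {X : measurableType d} {R : realType}.
Variable mu : {measure set X -> \bar R}.
Implicit Types f g : X -> R[i].
Local Notation normc := ComplexField.Normc.normc.

Lemma cmeasurable_real (a : X -> R) :
  measurable_fun setT a -> cmeasurable (fun x => (a x)%:C).
Proof. by move=> ma; split => //=; exact: measurable_cst. Qed.

Lemma cmeasurableD f g : cmeasurable f -> cmeasurable g ->
  cmeasurable (fun x => f x + g x).
Proof.
move=> [fr fi] [gr gi]; split.
- by rewrite (_ : (fun _ => _) = (fun x => complex.Re (f x) + complex.Re (g x)));
    [exact: measurable_funD|apply/funext => x; rewrite raddfD].
- by rewrite (_ : (fun _ => _) = (fun x => complex.Im (f x) + complex.Im (g x)));
    [exact: measurable_funD|apply/funext => x; rewrite raddfD].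
Qed.

Lemma cmeasurableM f g : cmeasurable f -> cmeasurable g ->
  cmeasurable (fun x => f x * g x).
Proof.
move=> [fr fi] [gr gi]; split.
- under eq_fun do rewrite complexReM.
  by apply: measurable_funB; exact: measurable_funM.
- under eq_fun do rewrite complexImM.
  by apply: measurable_funD; exact: measurable_funM.
Qed.

Lemma cmeasurableJ f : cmeasurable f -> cmeasurable (fun x => (f x)^*%C).
Proof.
move=> [fr fi]; split.
- by under eq_fun do rewrite complexReJ.
- by under eq_fun do rewrite complexImJ; exact: measurableT_comp.
Qed.

Lemma cmeasurable_cst (k : R[i]) : cmeasurable (fun _ : X => k).
Proof. by split; exact: measurable_cst. Qed.

Lemma cmeasurableB f g : cmeasurable f -> cmeasurable g ->
  cmeasurable (fun x => f x - g x).
Proof.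
move=> mf mg; under eq_fun do rewrite -mulN1r.
by apply: cmeasurableD => //; apply: cmeasurableM => //; exact: cmeasurable_cst.
Qed.

Lemma cmeasurableX2 f : cmeasurable f -> cmeasurable (fun x => f x ^+ 2).
Proof. by move=> mf; under eq_fun do rewrite expr2; exact: cmeasurableM. Qed.

Lemma cmeasurable_sqr_normc f : cmeasurable f ->
  measurable_fun setT (fun x => normc (f x) ^+ 2).
Proof.
move=> [fr fi]; under eq_fun do rewrite sqr_normcE.
by apply: measurable_funD; exact: measurable_funX.
Qed.

Lemma cmeasurable_normc f : cmeasurable f -> measurable_fun setT (fun x => normc (f x)).
Proof.
move=> mf; rewrite (_ : (fun _ => _) = Num.sqrt \o (fun x => normc (f x) ^+ 2)).
  apply: measurableT_comp; last exact: cmeasurable_sqr_normc.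
  by apply: continuous_measurable_fun; exact: sqrt_continuous.
by apply/funext => x /=; rewrite sqrtr_sqr ger0_norm// normc_ge0.
Qed.

Lemma cLnorm1E f : cLnorm mu 1%:E f = (\int[mu]_x (normc (f x))%:E)%E.
Proof.
rewrite /cLnorm Lnorm1; apply: eq_integral => x _.
by rewrite gee0_abs// lee_fin normc_ge0.
Qed.

Lemma memL2P f : memLp mu 2%:E f <->
  cmeasurable f /\ (\int[mu]_x (normc (f x) ^+ 2)%:E < +oo)%E.
Proof.
rewrite /memLp; suff -> : (cLnorm mu 2%:E f < +oo)%E =
    (\int[mu]_x (normc (f x) ^+ 2)%:E < +oo)%E by [].
rewrite /cLnorm unlock.
rewrite (eq_integral (fun x => (normc (f x) ^+ 2)%:E)); last first.
  by move=> x _; rewrite gee0_abs ?lee_fin ?normc_ge0// poweR_EFin powR_mulrn// normc_ge0.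
(* Nonnegativity excludes [-oo]; if the integral is [+oo], so is its power 1/2, the exponent being
   nonzero. *)
have : (0 <= \int[mu]_x (normc (f x) ^+ 2)%:E)%E.
  by apply: integral_ge0 => x _; rewrite lee_fin exprn_ge0// normc_ge0.
case: (integral _ _ _) => [r| |]//= _; first by rewrite !ltry.
by rewrite invr_eq0 pnatr_eq0.
Qed.

Lemma memL1_sqr f : memLp mu 2%:E f -> memLp mu 1%:E (fun x => f x ^+ 2).
Proof.
move=> /memL2P[mf fi]; split; first exact: cmeasurableX2.
by rewrite cLnorm1E; under eq_integral do rewrite normcX.
Qed.

Lemma memL1_le (g f : X -> R[i]) : cmeasurable g -> memLp mu 1%:E f ->
  (forall x, normc (g x) <= normc (f x)) -> memLp mu 1%:E g.
Proof.
move=> mg [mf]; rewrite cLnorm1E => fi gf; split => //; rewrite cLnorm1E.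
apply: le_lt_trans fi; apply: ge0_le_integral => //.
- by move=> x _; rewrite lee_fin normc_ge0.
- by apply/measurable_EFinP; exact: cmeasurable_normc.
- by apply/measurable_EFinP; exact: cmeasurable_normc.
- by move=> x _; rewrite lee_fin.
Qed.

(** The combination has the shape used in the linearity clause of [bounded_operator]. *)
Lemma memL1_linear (k : R[i]) f g : memLp mu 1%:E f -> memLp mu 1%:E g ->
  memLp mu 1%:E (fun x => k * f x + g x).
Proof.
move=> [mf]; rewrite cLnorm1E => fi [mg]; rewrite cLnorm1E => gi; split.
  by apply: cmeasurableD => //; apply: cmeasurableM => //; exact: cmeasurable_cst.
have mnf : measurable_fun setT (fun x => (normc (f x))%:E).
  by apply/measurable_EFinP; exact: cmeasurable_normc.
have mng : measurable_fun setT (fun x => (normc (g x))%:E).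
  by apply/measurable_EFinP; exact: cmeasurable_normc.
rewrite cLnorm1E; apply: (@le_lt_trans _ _
    ((normc k)%:E * (\int[mu]_x (normc (f x))%:E) + \int[mu]_x (normc (g x))%:E)%E).
  rewrite -ge0_integralZl//; last 2 first.
  - by move=> x _; rewrite lee_fin normc_ge0.
  - by rewrite lee_fin normc_ge0.
  rewrite -ge0_integralD//; last 3 first.
  - by move=> x _; rewrite -EFinM lee_fin mulr_ge0// normc_ge0.
  - exact: measurable_funeM.
  - by move=> x _; rewrite lee_fin normc_ge0.
  apply: ge0_le_integral => //.
  - by move=> x _; rewrite lee_fin normc_ge0.
  - apply/measurable_EFinP; apply: cmeasurable_normc.
    by apply: cmeasurableD => //; apply: cmeasurableM => //; exact: cmeasurable_cst.
  - by apply: emeasurable_funD => //; exact: measurable_funeM.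
  - move=> x _; rewrite -EFinM -EFinD lee_fin -ComplexField.Normc.normcM.
    exact: le_normcD.
by rewrite lte_add_pinfty// lte_mul_pinfty// lee_fin normc_ge0.
Qed.

Lemma memL1_integrableRe f (A : set X) : measurable A -> memLp mu 1%:E f ->
  mu.-integrable A (fun x => (complex.Re (f x))%:E).
Proof.
move=> mA [mf fi]; apply: (@integrableS _ _ _ mu setT) => //.
apply/integrableP; split; first by apply/measurable_EFinP; case: mf.
apply: le_lt_trans fi; rewrite cLnorm1E; apply: ge0_le_integral => //.
- by apply/measurable_EFinP; apply: measurableT_comp => //; case: mf.
- by apply/measurable_EFinP; exact: cmeasurable_normc.
- by move=> x _; rewrite lee_fin normc_Re_le.
Qed.

Lemma memL1_integrableIm f (A : set X) : measurable A -> memLp mu 1%:E f ->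
  mu.-integrable A (fun x => (complex.Im (f x))%:E).
Proof.
move=> mA [mf fi]; apply: (@integrableS _ _ _ mu setT) => //.
apply/integrableP; split; first by apply/measurable_EFinP; case: mf.
apply: le_lt_trans fi; rewrite cLnorm1E; apply: ge0_le_integral => //.
- by apply/measurable_EFinP; apply: measurableT_comp => //; case: mf.
- by apply/measurable_EFinP; exact: cmeasurable_normc.
- by move=> x _; rewrite lee_fin normc_Im_le.
Qed.

Lemma cintegral_ae_eq f g : memLp mu 1%:E f -> memLp mu 1%:E g ->
  (forall A, measurable A -> cintegral mu A f = cintegral mu A g) ->
  f = g %[ae mu].
Proof.
move=> fL gL fg.
have re : ae_eq mu setT (fun x => (complex.Re (f x))%:E) (fun x => (complex.Re (g x))%:E).
  apply: integral_ae_eq => //; first exact: memL1_integrableRe.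
    by apply/measurable_EFinP; case: gL => -[].
  move=> A _ mA; have [+ _] := fg A mA; rewrite /Rintegral => h.
  by apply: fin_num_fine_inj h; apply: integrable_fin_num => //; exact: memL1_integrableRe.
have im : ae_eq mu setT (fun x => (complex.Im (f x))%:E) (fun x => (complex.Im (g x))%:E).
  apply: integral_ae_eq => //; first exact: memL1_integrableIm.
    by apply/measurable_EFinP; case: gL => -[].
  move=> A _ mA; have [_ +] := fg A mA; rewrite /Rintegral => h.
  by apply: fin_num_fine_inj h; apply: integrable_fin_num => //; exact: memL1_integrableIm.
apply: filterS2 re im => x re im _.
by apply/eqP; rewrite eq_complex; move: (re I) (im I) => -[->] [->]; rewrite !eqxx.
Qed.

Lemma cintegral_ae f g (A : set X) : measurable A -> cmeasurable f -> cmeasurable g ->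
  f = g %[ae mu] -> cintegral mu A f = cintegral mu A g.
Proof.
move=> mA [fr fi] [gr gi] fg; congr (_ +i* _); congr fine.
- apply: ae_eq_integral => //; try by apply/measurable_EFinP; exact: measurable_funTS.
  by apply: filterS fg => x /(_ I) -> _.
- apply: ae_eq_integral => //; try by apply/measurable_EFinP; exact: measurable_funTS.
  by apply: filterS fg => x /(_ I) -> _.
Qed.

Lemma cLnorm1_ae f g : cmeasurable f -> cmeasurable g -> f = g %[ae mu] ->
  cLnorm mu 1%:E f = cLnorm mu 1%:E g.
Proof.
move=> mf mg fg; rewrite !cLnorm1E; apply: ae_eq_integral => //.
- by apply/measurable_EFinP; exact: cmeasurable_normc.
- by apply/measurable_EFinP; exact: cmeasurable_normc.
- by apply: filterS fg => x /(_ I) -> _.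
Qed.

Lemma integrable_sqr_normc f : memLp mu 2%:E f ->
  mu.-integrable setT (fun x => (normc (f x) ^+ 2)%:E).
Proof.
move=> /memL2P[mf fi]; apply/integrableP; split.
  by apply/measurable_EFinP; exact: cmeasurable_sqr_normc.
by under eq_integral do rewrite gee0_abs ?lee_fin ?exprn_ge0 ?normc_ge0//.
Qed.

(** The integrand is dominated by the sum of the squared moduli of [f] and [g]. *)
Lemma integrable_Re_inner f g : memLp mu 2%:E f -> memLp mu 2%:E g ->
  mu.-integrable setT (fun x => (complex.Re (f x * (g x)^*%C))%:E).
Proof.
move=> fL gL; have fi := integrable_sqr_normc fL; have gi := integrable_sqr_normc gL.
apply: (le_integrable measurableT _ _ (integrableD measurableT fi gi)).
  have /memL2P[[fr fm] _] := fL; have /memL2P[[gr gm] _] := gL.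
  apply/measurable_EFinP; under eq_fun do rewrite complexReM complexReJ complexImJ.
  apply: measurable_funB; apply: measurable_funM => //.
  exact: measurableT_comp.
move=> x _; rewrite /= lee_fin.
by rewrite [leRHS]ger0_norm ?addr_ge0 ?exprn_ge0 ?normc_ge0// normr_ReMJ_le.
Qed.

Lemma memL2B f g : memLp mu 2%:E f -> memLp mu 2%:E g ->
  memLp mu 2%:E (fun x => f x - g x).
Proof.
move=> fL gL; have fi := integrable_sqr_normc fL; have gi := integrable_sqr_normc gL.
have /memL2P[mf _] := fL; have /memL2P[mg _] := gL.
have mB := cmeasurableB mf mg; apply/memL2P; split => //.
have : mu.-integrable setT (fun x => (normc (f x - g x) ^+ 2)%:E).
  apply: (le_integrable measurableT _ _
    (integrableZl measurableT 2 (integrableD measurableT fi gi))).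
    by apply/measurable_EFinP; exact: cmeasurable_sqr_normc.
  move=> x _; rewrite /= lee_fin.
  rewrite !ger0_norm ?mulr_ge0 ?addr_ge0 ?exprn_ge0 ?normc_ge0//.
  exact: sqr_normcB_le.
move=> /integrableP[_]; under eq_integral do
  rewrite gee0_abs ?lee_fin ?exprn_ge0 ?normc_ge0//.
by [].
Qed.

(* Test against [f - g]. *)
Lemma Re_inner_ae_eq f g : memLp mu 2%:E f -> memLp mu 2%:E g ->
  (forall w, memLp mu 2%:E w ->
    complex.Re (inner mu f w) = complex.Re (inner mu g w)) ->
  f = g %[ae mu].
Proof.
move=> fL gL fg; pose w x := f x - g x.
have wL : memLp mu 2%:E w by exact: memL2B.
have /memL2P[mw _] := wL.
have mw2 : measurable_fun setT (fun x => (normc (w x) ^+ 2)%:E).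
  by apply/measurable_EFinP; exact: cmeasurable_sqr_normc.
have : (\int[mu]_x `|(normc (w x) ^+ 2)%:E| = 0)%E.
  have h : (\int[mu]_x (complex.Re (f x * (w x)^*%C))%:E
      = \int[mu]_x (complex.Re (g x * (w x)^*%C))%:E)%E.
    apply: fin_num_fine_inj (fg w wL); apply: integrable_fin_num => //;
      exact: integrable_Re_inner.
  transitivity (\int[mu]_x ((complex.Re (f x * (w x)^*%C))%:E
                            - (complex.Re (g x * (w x)^*%C))%:E))%E.
    apply: eq_integral => x _; rewrite gee0_abs ?lee_fin ?exprn_ge0 ?normc_ge0//.
    rewrite -EFinB [in RHS](_ : _ - _ = complex.Re (w x * (w x)^*%C)).
      rewrite complexReM complexReJ complexImJ mulrN opprK sqr_normcE.
      by rewrite !expr2.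
    by rewrite -raddfB -mulrBl.
  rewrite integralB//; try exact: integrable_Re_inner.
  by rewrite h subee// integrable_fin_num//; exact: integrable_Re_inner.
move=> /(ae_eq_integral_abs mu measurableT mw2).
apply: filterS => x /(_ I)[] /eqP; rewrite sqrf_eq0 => /eqP h _.
by apply/eqP; rewrite -subr_eq0; apply/eqP; exact: ComplexField.Normc.eq0_normc.
Qed.

End complex_Lp.

(** * Inverses and indicator functions under the integral *)

Section real_integrals.
Context {d : measure_display} {X : measurableType d} {R : realType}.
Variable mu : {measure set X -> \bar R}.
Implicit Types (A D : set X) (h : X -> R).

(** The inverse is the power with exponent -1, also at the zeros of [h], where both are 0 by
    convention. *)
Lemma measurable_funV_ge0 D h : measurable_fun D h -> (forall x, 0 <= h x) ->
  measurable_fun D (fun x => (h x)^-1).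
Proof.
move=> mh h0; rewrite (_ : (fun _ => _) = (fun x => h x `^ (- 1))).
  exact: (measurableT_comp (measurable_powR _)).
by apply/funext => x; rewrite powR_inv1.
Qed.

(** The maps of a branching system are measurable on their domains only; cutting off by the
    indicator makes the functions built from them measurable on the whole space. *)
Lemma measurable_indicM D h : measurable D -> measurable_fun D h ->
  measurable_fun setT (fun x => \1_D x * h x).
Proof.
move=> mD mh; rewrite (_ : (fun _ => _) = h \_ D).
  exact/(measurable_restrictT _ mD).
by rewrite patch_indic; apply/funext => x /=; rewrite mulrC.
Qed.

(** Both sides integrate [h] over the intersection of [A] and [D]. Exchanging the roles of the two
    sets brings an integral into the form, over a domain [D], to which the change of variables
    applies. *)
Lemma integral_indicC A D h :
  (\int[mu]_(x in A) (\1_D x * h x)%:E = \int[mu]_(x in D) (\1_A x * h x)%:E)%E.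
Proof.
rewrite integral_mkcond [RHS]integral_mkcond; apply: eq_integral => x _.
rewrite !patchE !indicE; case: (x \in A); case: (x \in D) => //=;
  by rewrite mul0r.
Qed.

End real_integrals.

(** * A single edge: positivity of the derivative, the adjoint, and the integral of its square *)

Section branch.
Context {R : realType} {E : digraph} {d : measure_display} {X : measurableType d}.
Context {mu : {measure set X -> \bar R}}.
Variables (B : branching_system E mu) (e : edge E).
Implicit Types (phi : X -> R[i]).
Local Notation normc := ComplexField.Normc.normc.

Let D := bs_D B (range_of e).
Let Q := bs_R B e.
Let f := bs_f B e.
Let q := bs_finv B e.
Let Psi := bs_Phiinv B e.

Let mD : measurable D. Proof. exact: bs_measurableD. Qed.
Let mQ : measurable Q. Proof. exact: bs_measurableR. Qed.
Let mf : measurable_fun D f. Proof. exact: bs_f_measurable. Qed.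
Let mq : measurable_fun Q q. Proof. exact: bs_finv_measurable. Qed.
Let fD x : D x -> Q (f x). Proof. exact: bs_f_maps. Qed.
Let qQ x : Q x -> D (q x). Proof. exact: bs_finv_maps. Qed.
Let dq : image_derivative mu Q q Psi. Proof. exact: bs_finv_derivative. Qed.
Let mPsi : measurable_fun setT Psi. Proof. by case: dq. Qed.
Let Psi_ge0 x : 0 <= Psi x. Proof. by case: dq. Qed.
Let fqK : \forall x \ae mu, Q x -> f (q x) = x. Proof. exact: bs_finvK. Qed.

Let q_onto : \forall y \ae mu, D y -> (q @` Q) y.
Proof.
apply: filterS (bs_fK B e) => y fy Dy; exists (f y); first exact: fD.
exact: fy.
Qed.

(** Let [Z] be the zero set of [Psi] in [Q]. Its image under [q] has measure the integral of [Psi]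
    over [Z], which is 0; the image of that null set under [f] is again null, as its measure is an
    integral of [Phi_{f_e}] over a null set. Almost every point [x] of [Z] equals [f (q x)] and so
    lies in this null set. *)
Lemma bs_Phiinv_gt0 : \forall x \ae mu, bs_R B e x -> 0 < bs_Phiinv B e x.
Proof.
pose Z := Q `&` Psi @^-1` [set 0].
have mZ : measurable Z by apply: measurable_funTS.
have [_ _ _ /(_ Z mZ (@subIsetl _ _ _))[mqZ qZ]] := dq.
have qZ0 : mu (q @` Z) = 0%E.
  by rewrite qZ integral0_eq// => x [_ ->].
have qZD : q @` Z `<=` D by move=> _ [x [Qx _] <-]; exact: qQ.
have [mPhi _ _ /(_ _ mqZ qZD)[mfqZ fqZ]] := bs_f_derivative B e.
have fqZ0 : mu (f @` (q @` Z)) = 0%E.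
  rewrite fqZ null_set_integral//; apply/measurable_EFinP; exact: measurable_funTS.
have nZ : \forall x \ae mu, ~ (f @` (q @` Z)) x.
  by exists (f @` (q @` Z)); split => // x /contrapT.
apply: filterS2 nZ fqK => x nZx fqx Qx; rewrite lt_def Psi_ge0 andbT.
apply/eqP => Px0; apply: nZx; exists (q x); last exact: fqx.
by exists x.
Qed.

(** This is the formula prescribed for [pi (S e)] in the induced representation. *)
Definition bs_isometry (w : X -> R[i]) (x : X) : R[i] :=
  (\1_(bs_R B e) x * Num.sqrt (bs_Phiinv B e x))%:C * w (bs_finv B e x).

(* The Hilbert space adjoint of [bs_isometry]. It is written with the factor
   [Phi_{f_e^-1}(f_e y)^(-1/2)] instead of [Phi_{f_e}(y)^(1/2)]; the two agree
   almost everywhere on sigma-finite sets, but this form avoids the chain rule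
   for Radon-Nikodym derivatives. *)
Definition bs_adjoint phi (y : X) : R[i] :=
  (\1_D y * (Num.sqrt (Psi (f y)))^-1)%:C * phi (f y).

Let m_f (a : X -> R) : measurable_fun setT a -> measurable_fun D (fun y => a (f y)).
Proof. by move=> ma; apply: (measurableT_comp ma). Qed.

Let m_q (a : X -> R) : measurable_fun setT a -> measurable_fun Q (fun y => a (q y)).
Proof. by move=> ma; apply: (measurableT_comp ma). Qed.

Let msqrt : measurable_fun setT (fun x => Num.sqrt (Psi x)).
Proof.
by apply: measurableT_comp => //; apply: continuous_measurable_fun; exact: sqrt_continuous.
Qed.

Let ms : measurable_fun D (fun y => (Num.sqrt (Psi (f y)))^-1).
Proof. by apply: measurable_funV_ge0 => [|x]; [exact: m_f msqrt|exact: sqrtr_ge0]. Qed.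

Lemma bs_adjoint_measurable phi : cmeasurable phi -> cmeasurable (bs_adjoint phi).
Proof.
move=> [mr mi]; split; rewrite /bs_adjoint.
- under eq_fun do rewrite complexReZ -mulrA.
  by apply: measurable_indicM => //; apply: measurable_funM => //; exact: m_f mr.
- under eq_fun do rewrite complexImZ -mulrA.
  by apply: measurable_indicM => //; apply: measurable_funM => //; exact: m_f mi.
Qed.

Lemma bs_isometry_measurable w : cmeasurable w -> cmeasurable (bs_isometry w).
Proof.
move=> [mr mi]; split; rewrite /bs_isometry.
- under eq_fun do rewrite complexReZ -mulrA.
  apply: measurable_indicM => //; apply: measurable_funM; last exact: m_q mr.
  exact: measurable_funTS.
- under eq_fun do rewrite complexImZ -mulrA.
  apply: measurable_indicM => //; apply: measurable_funM; last exact: m_q mi.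
  exact: measurable_funTS.
Qed.

(** Substitute [y = q x]. Almost everywhere on [R_e], [f (q x) = x], so the factor [Psi x] cancels
    its inverse, and [F x = q x], so the indicator of [A] at [q x] is that of the preimage of [A]
    under [F] at [x]. *)
Lemma integral_bs_adjoint (F : X -> X) (A : set X) (a : X -> R) :
  measurable_fun setT F -> F = bs_finv B e %[ae mu in bs_R B e] ->
  measurable A -> measurable_fun setT a ->
  (\int[mu]_(y in A) (\1_D y * ((Psi (f y))^-1 * a (f y)))%:E
   = \int[mu]_(x in F @^-1` A) (\1_(bs_R B e) x * a x)%:E)%E.
Proof.
move=> mF Fq mA ma.
have mFA : measurable (F @^-1` A) by rewrite -[X in measurable X]setTI; exact: mF.
rewrite (integral_indicC mu A D) (integral_indicC mu _ (bs_R B e)).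
apply: (integral_image_derivative mD mQ mq qQ q_onto dq
  (h := fun y => \1_A y * ((Psi (f y))^-1 * a (f y)))
  (k := fun x => \1_(F @^-1` A) x * a x)).
- apply: measurable_funM; first exact: measurable_indic.
  by apply: measurable_funM; [apply: measurable_funV_ge0 => //; exact: m_f|exact: m_f].
- by apply: measurable_funM; [exact: measurable_indic|exact: measurable_funTS].
apply: filterS3 Fq fqK bs_Phiinv_gt0 => x Fx fqx Px Qx.
rewrite /= fqx// -mulrA [_^-1 * _ * _]mulrAC mulVf ?gt_eqF ?Px// mul1r.
by rewrite !indicE -[q x](Fx Qx).
Qed.

(** The change of variables turns the integral of the squared modulus into that of
    [normc (phi x) ^+ 2] over [R_e], which is at most the integral over [X]. *)
Lemma memL2_bs_adjoint phi : memLp mu 2%:E phi -> memLp mu 2%:E (bs_adjoint phi).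
Proof.
move=> /memL2P[mphi iphi]; apply/memL2P; split; first exact: bs_adjoint_measurable.
have mphi2 := cmeasurable_sqr_normc mphi.
rewrite (eq_integral (fun y => (\1_D y * ((Psi (f y))^-1 * normc (phi (f y)) ^+ 2))%:E)).
  (* The exchange leaves behind the indicator of [setT], a factor 1 that has to appear in [h]
     below. *)
  rewrite (integral_indicC mu setT D).
  rewrite (integral_image_derivative mD mQ mq qQ q_onto dq
    (h := fun y => \1_setT y * ((Psi (f y))^-1 * normc (phi (f y)) ^+ 2))
    (k := fun x => normc (phi x) ^+ 2)).
  - apply: le_lt_trans iphi; apply: ge0_subset_integral => //.
    + exact/measurable_EFinP.
    + by move=> x _; rewrite lee_fin exprn_ge0// normc_ge0.
  - apply: measurable_funM; first exact: measurable_indic.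
    apply: measurable_funM; last exact: m_f mphi2.
    by apply: measurable_funV_ge0 => //; exact: m_f.
  - exact: measurable_funTS.
  - apply: filterS2 fqK bs_Phiinv_gt0 => x fqx Px Qx.
    by rewrite indicT/= mul1r fqx// mulrAC mulVf ?mul1r// gt_eqF// Px.
move=> y _; congr EFin.
rewrite normcZ exprMn normrM exprMn !real_normK ?num_real// [RHS]mulrA.
rewrite exprVn sqr_sqrtr//; congr (_ * _ * _).
by rewrite indicE; case: (_ \in _); rewrite ?expr1n ?expr0n.
Qed.

(** Under [y = q x] the factor [Psi^(-1/2)] meets the density [Psi], leaving the [Psi^(1/2)] of
    [bs_isometry]. Real parts are enough for [Re_inner_ae_eq]. *)
Lemma Re_inner_bs_adjoint phi w : cmeasurable phi -> cmeasurable w ->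
  complex.Re (inner mu (bs_adjoint phi) w) =
  complex.Re (inner mu phi (bs_isometry w)).
Proof.
move=> [mphir mphii] [mwr mwi]; congr fine.
transitivity (\int[mu]_y (\1_D y * ((Num.sqrt (Psi (f y)))^-1 *
    complex.Re (phi (f y) * (w y)^*%C)))%:E)%E.
  apply: eq_integral => y _; congr EFin.
  by rewrite -mulrA complexReZ mulrA.
transitivity (\int[mu]_x (\1_Q x * (Num.sqrt (Psi x) *
    complex.Re (phi x * (w (q x))^*%C)))%:E)%E; last first.
  by apply: eq_integral => x _; congr EFin; rewrite complexReZJ mulrA.
rewrite (integral_indicC mu setT D) (integral_indicC mu setT Q).
apply: (integral_image_derivative mD mQ mq qQ q_onto dq
  (h := fun y => \1_setT y * ((Num.sqrt (Psi (f y)))^-1 *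
    complex.Re (phi (f y) * (w y)^*%C)))
  (k := fun x => \1_setT x * (Num.sqrt (Psi x) *
    complex.Re (phi x * (w (q x))^*%C)))).
- apply: measurable_funM; first exact: measurable_indic.
  apply: measurable_funM => //.
  under eq_fun do rewrite complexReM complexReJ complexImJ.
  apply: measurable_funB; apply: measurable_funM.
  + exact: m_f mphir.
  + exact: measurable_funTS.
  + exact: m_f mphii.
  + by apply: measurableT_comp => //; exact: measurable_funTS.
- apply: measurable_funM; first exact: measurable_indic.
  apply: measurable_funM; first exact: measurable_funTS.
  under eq_fun do rewrite complexReM complexReJ complexImJ.
  apply: measurable_funB; apply: measurable_funM.
  + exact: measurable_funTS.
  + exact: m_q mwr.
  + exact: measurable_funTS.
  + by apply: measurableT_comp => //; exact: m_q mwi.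
- apply: filterS2 fqK bs_Phiinv_gt0 => x fqx Px Qx.
  rewrite indicT/= !mul1r fqx// mulrAC; congr (_ * _).
  have sP : Num.sqrt (Psi x) != 0 by rewrite gt_eqF// sqrtr_gt0 Px.
  by rewrite -[X in _ * X](sqr_sqrtr (Psi_ge0 x)) expr2 mulrA mulVf// mul1r.
Qed.

(** Squaring removes the square root and leaves the indicator unchanged, so [integral_bs_adjoint]
    applies to the real and imaginary parts of [phi ^+ 2]. *)
Lemma cintegral_bs_adjoint_sqr (F : X -> X) (A : set X) phi :
  measurable_fun setT F -> F = bs_finv B e %[ae mu in bs_R B e] ->
  measurable A -> cmeasurable phi ->
  cintegral mu A (fun y => bs_adjoint phi y ^+ 2)
  = cintegral mu (F @^-1` A) (fun x => (\1_(bs_R B e) x)%:C * phi x ^+ 2).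
Proof.
move=> mF Fq mA mphi; have [mr mi] := cmeasurableX2 mphi.
have sqrE y : bs_adjoint phi y ^+ 2 = (\1_D y * (Psi (f y))^-1)%:C * phi (f y) ^+ 2.
  rewrite /bs_adjoint exprMn -rmorphXn/= exprMn exprVn sqr_sqrtr//.
  by rewrite indicE; case: (_ \in _); rewrite ?expr1n ?expr0n.
congr (_ +i* _); congr fine.
- under eq_integral do rewrite sqrE complexReZ -mulrA.
  under [RHS]eq_integral do rewrite complexReZ.
  exact: (integral_bs_adjoint mF Fq mA mr).
- under eq_integral do rewrite sqrE complexImZ -mulrA.
  under [RHS]eq_integral do rewrite complexImZ.
  exact: (integral_bs_adjoint mF Fq mA mi).
Qed.

End branch.

(** * Countable families of almost everywhere statements, and sums over disjoint ranges *)

Section theorem_4_4.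
Context {R : realType} {E : digraph} {d : measure_display} {X : measurableType d}.
Context {mu : {measure set X -> \bar R}}.
Local Notation normc := ComplexField.Normc.normc.

Lemma ae_forall_count (I : countType) (P : I -> X -> Prop) :
  (forall i, \forall x \ae mu, P i x) -> \forall x \ae mu, forall i, P i x.
Proof.
(* The family is reindexed by natural numbers; a code of no element of [I] imposes no condition. *)
move=> aeP; pose Q n x := forall i, unpickle n = Some i -> P i x.
have : \forall x \ae mu, forall n, Q n x.
  apply: ae_foralln => n; rewrite /Q; case: (unpickle n) => [i|].
    by apply: filterS (aeP i) => x Px _ [<-].
  by apply: aeW => x i.
by apply: filterS => x Qx i; apply: (Qx (pickle i)); rewrite pickleK.
Qed.

(** There are countably many pairs of edges, so a single null set accounts for all the overlaps. *)
Lemma bs_R_ae_disjoint (B : branching_system E mu) :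
  \forall x \ae mu, forall c e, c <> e -> bs_R B c x -> ~ bs_R B e x.
Proof.
suff : \forall x \ae mu, forall ce : edge E * edge E,
    ce.1 <> ce.2 -> bs_R B ce.1 x -> ~ bs_R B ce.2 x.
  by apply: filterS => x dis c e; apply: (dis (c, e)).
apply: ae_forall_count => -[c e] /=.
have [<-|/eqP ce] := eqVneq c e; first exact: aeW.
have [+ _] := bs_disjointR B ce; rewrite /ae_subset setD0 => ec0.
exists (bs_R B e `&` bs_R B c); split => //.
  by apply: measurableI; exact: bs_measurableR.
by move=> x /= /not_implyP[_ /not_implyP[cx /contrapT ex]].
Qed.

Lemma sum_indic_bs_R (B : branching_system E mu) (I : finType) (e : I -> edge E)
    (x : X) (i : I) (z : R[i]) :
  (forall c e, c <> e -> bs_R B c x -> ~ bs_R B e x) -> injective e ->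
  bs_R B (e i) x -> \sum_j (\1_(bs_R B (e j)) x)%:C * z = z.
Proof.
move=> dis ie ix; rewrite (bigD1 i)//= indicE mem_set// mul1r big1 ?addr0// => j ji.
rewrite indicE memNset ?mul0r//; apply: dis ix => /ie ij.
by rewrite ij eqxx in ji.
Qed.

Lemma sum_indic_bs_R0 (B : branching_system E mu) (I : finType) (e : I -> edge E)
    (x : X) (z : R[i]) :
  (forall i, ~ bs_R B (e i) x) -> \sum_j (\1_(bs_R B (e j)) x)%:C * z = 0.
Proof. by move=> nx; rewrite big1// => j _; rewrite indicE memNset ?mul0r. Qed.

Lemma memL1_0 : memLp mu 1%:E (fun _ : X => 0 : R[i]).
Proof.
split; first exact: cmeasurable_cst.
rewrite cLnorm1E; under eq_integral do rewrite ComplexField.Normc.normc0.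
by rewrite integral0.
Qed.

(** * Finite sums under a bounded operator on L^1 *)

Section bounded_operator_L1.
Variables (T : (X -> R[i]) -> (X -> R[i])) (bT : bounded_operator mu 1%:E T).

Lemma bounded_operator_0 : T (fun=> 0) = (fun=> 0) %[ae mu].
Proof.
(* With both functions zero and scalar -1, linearity reads [T 0 = - T 0 + T 0]. *)
apply: filterS (bounded_operator_linear bT (-1) memL1_0 memL1_0) => x /(_ I) + _.
by under eq_fun do rewrite mulr0 addr0; rewrite mulN1r addNr.
Qed.

Lemma memL1_sum J (s : seq J) (g : J -> X -> R[i]) :
  (forall i, memLp mu 1%:E (g i)) -> memLp mu 1%:E (fun x => \sum_(i <- s) g i x).
Proof.
move=> gL; elim: s => [|i s IH].
  by under eq_fun do rewrite big_nil; exact: memL1_0.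
under eq_fun do rewrite big_cons -[g i _]mul1r.
exact: memL1_linear.
Qed.

Lemma bounded_operator_sum J (s : seq J) (g : J -> X -> R[i]) :
  (forall i, memLp mu 1%:E (g i)) ->
  T (fun x => \sum_(i <- s) g i x) = (fun x => \sum_(i <- s) T (g i) x) %[ae mu].
Proof.
move=> gL; elim: s => [|i s IH].
  apply: filterS bounded_operator_0 => x /(_ I) + _.
  rewrite big_nil => T0; rewrite -[RHS]T0; congr (T _ x).
  by apply/funext => y; rewrite big_nil.
have := bounded_operator_linear bT 1 (gL i) (memL1_sum s gL).
apply: filterS2 IH => x /(_ I) sx /(_ I) + _.
rewrite big_cons mul1r sx => Tx; rewrite -[RHS]Tx; congr (T _ x).
by apply/funext => y; rewrite big_cons mul1r.
Qed.

End bounded_operator_L1.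

(** * The Perron-Frobenius operator on functions supported in finitely many ranges *)

Variables (B : branching_system E mu) (F : X -> X).
Hypothesis hF : nonsingular_branching_system B F.
Variables (A : cstar_algebra R) (P : vertex E -> A) (S : edge E -> A).
Variable pi : A -> (X -> R[i]) -> (X -> R[i]).
Hypothesis hpi : induced_representation B P S pi.
Variable PF : (X -> R[i]) -> (X -> R[i]).
Hypothesis hPF : perron_frobenius mu F PF.
Variable phi : X -> R[i].
Hypothesis hphi : memLp mu 2%:E phi.

Let phi2 x := phi x ^+ 2.
Let cut e x := (\1_(bs_R B e) x)%:C * phi2 x.

Let phi2L : memLp mu 1%:E phi2. Proof. exact: memL1_sqr. Qed.

Let mphi : cmeasurable phi. Proof. by case: hphi. Qed.

Let cutL e : memLp mu 1%:E (cut e).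
Proof.
apply: (memL1_le _ phi2L).
  apply: cmeasurableM; last exact: cmeasurableX2.
  by apply: cmeasurable_real; apply: measurable_indic; exact: bs_measurableR.
move=> x; rewrite normcZ ger0_norm ?indicE; last by case: (_ \in _).
by rewrite ler_piMl ?normc_ge0//; case: (_ \in _).
Qed.

Let bpi a : bounded_operator mu 2%:E (pi a).
Proof. by case: hpi => -[]. Qed.

(** Both sides have the same real inner product with every [w] in L^2: [star_repS] moves
    [pi (star (S e))] to [pi (S e) w], which is almost everywhere [bs_isometry] of [w]. *)
Lemma induced_representation_star e : pi (star (S e)) phi = bs_adjoint B e phi %[ae mu].
Proof.
have [[_ _ _ _ piS] piE _] := hpi.
apply: Re_inner_ae_eq; [exact: bounded_operator_mem|exact: memL2_bs_adjoint|move=> w wL].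
have [mw _] := wL.
have [mpw _] := bounded_operator_mem (bpi (S e)) wL.
rewrite piS// Re_inner_bs_adjoint//; congr complex.Re.
apply: cintegral_ae => //.
- by apply: cmeasurableM => //; exact: cmeasurableJ.
- by apply: cmeasurableM => //; apply: cmeasurableJ; exact: bs_isometry_measurable.
- by apply: filterS (piE e w wL) => x /(_ I) -> _.
Qed.

(** Over every measurable set [U], both sides have the integral of [cut e] over the preimage of [U]
    under [F], and integrals over all measurable sets determine an L^1 function. *)
Lemma perron_frobenius_edge e :
  PF (cut e) = (fun x => pi (star (S e)) phi x ^+ 2) %[ae mu].
Proof.
have [bPF intPF] := hPF; have [[mF _] /(_ e) Fq] := hF.
have h : PF (cut e) = (fun x => bs_adjoint B e phi x ^+ 2) %[ae mu].
  apply: cintegral_ae_eq.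
  - exact: bounded_operator_mem.
  - by apply: memL1_sqr; exact: memL2_bs_adjoint.
  - by move=> U mU; rewrite intPF// (cintegral_bs_adjoint_sqr mF Fq).
apply: filterS2 h (induced_representation_star e) => x /(_ I) -> /(_ I) <- _ //.
Qed.

Lemma perron_frobenius_sum (J : finType) (e : J -> edge E) :
  PF (fun x => \sum_i cut (e i) x)
  = (fun x => \sum_i pi (star (S (e i))) phi x ^+ 2) %[ae mu].
Proof.
have [bPF _] := hPF.
have := bounded_operator_sum bPF (index_enum J) (fun i => cutL (e i)).
have : \forall x \ae mu, forall i, PF (cut (e i)) x = pi (star (S (e i))) phi x ^+ 2.
  apply: ae_forall_count => i.
  by apply: filterS (perron_frobenius_edge (e i)) => x; exact.
apply: filterS2 => x ex /(_ I) -> _; apply: eq_bigr => i _; exact: ex.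
Qed.

(** Off a null set, [phi2] is the sum of its cuts: a point of the union lies in exactly one of the
    ranges, and elsewhere [phi] vanishes. *)
Lemma perron_frobenius_finite_support (J : finType) (e : J -> edge E) : injective e ->
  ae_support mu phi (\bigcup_i bs_R B (e i)) ->
  PF phi2 = (fun x => \sum_i pi (star (S (e i))) phi x ^+ 2) %[ae mu].
Proof.
move=> ie; rewrite /ae_support => supp; have [bPF _] := hPF.
have phi2E : phi2 = (fun x => \sum_i cut (e i) x) %[ae mu].
  apply: filterS2 supp (bs_R_ae_disjoint B) => x supx dis _.
  have [[i _ ix]|nx] := pselect ((\bigcup_i bs_R B (e i)) x).
    by rewrite (sum_indic_bs_R _ dis ie ix).
  rewrite sum_indic_bs_R0 => [|i ix]; last by apply: nx; exists i.
  by rewrite /phi2 supx// expr0n.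
have := bounded_operator_ae bPF phi2L (memL1_sum _ (fun i => cutL (e i))) phi2E.
by apply: filterS2 (perron_frobenius_sum e) => x /(_ I) <- /(_ I) -> _.
Qed.

(** * Infinite sequences of edges: remainders and convergence in L^1 *)

Let rest (e : nat -> edge E) N x := phi2 x - \sum_(j < N) cut (e j) x.

Let restL e N : memLp mu 1%:E (rest e N).
Proof.
have := memL1_linear (-1) (memL1_sum (index_enum 'I_N) (fun j => cutL (e j))) phi2L.
by under eq_fun do rewrite mulN1r addrC.
Qed.

(** Dominated convergence: at almost every point the remainder is either [phi2 x] or 0, hence
    bounded by the integrable [normc (phi x) ^+ 2], and it is eventually 0. *)
Lemma cvg_cLnorm_rest (e : nat -> edge E) : injective e ->
  ae_support mu phi (\bigcup_j bs_R B (e j)) ->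
  cLnorm mu 1%:E (rest e N) @[N --> \oo] --> 0%E.
Proof.
move=> ie; rewrite /ae_support => supp.
have ieN N : injective (fun j : 'I_N => e j) by move=> i j /ie /val_inj.
have mrest N : measurable_fun setT (fun x => (normc (rest e N x))%:E).
  by apply/measurable_EFinP; apply: cmeasurable_normc; case: (restL e N).
have dom : \forall x \ae mu, forall N, setT x ->
    (`|(normc (rest e N x))%:E| <= (normc (phi x) ^+ 2)%:E)%E.
  apply: filterS (bs_R_ae_disjoint B) => x dis N _.
  rewrite gee0_abs ?lee_fin ?normc_ge0// -normcX -/(phi2 x) /rest.
  have [[j jx]|nx] := pselect (exists j : 'I_N, bs_R B (e j) x).
    by rewrite (sum_indic_bs_R _ dis (ieN N) jx) subrr ComplexField.Normc.normc0 normc_ge0.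
  by rewrite sum_indic_bs_R0 ?subr0// => j jx; apply: nx; exists j.
have lim0 : \forall x \ae mu, setT x ->
    (normc (rest e N x))%:E @[N --> \oo] --> (0 : \bar R)%E.
  apply: filterS2 supp (bs_R_ae_disjoint B) => x supx dis _.
  apply: cvg_near_cst.
  have [[j _ jx]|nx] := pselect ((\bigcup_j bs_R B (e j)) x).
    (* The sum runs over indices below [N], so it contains the index [j] from [N = j.+1] on. *)
    exists j.+1 => // N /= jN; rewrite /rest.
    rewrite (sum_indic_bs_R (i := Ordinal jN) _ dis (ieN N) jx).
    by rewrite subrr ComplexField.Normc.normc0.
  apply: nearW => N; rewrite /rest sum_indic_bs_R0; last first.
    by move=> j jx; apply: nx; exists j.
  by rewrite /phi2 supx// expr0n subr0 ComplexField.Normc.normc0.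
have [_ _] := dominated_convergence measurableT mrest (measurable_cst 0%E) lim0
  (integrable_sqr_normc hphi) dom.
by rewrite integral0; under [X in _ -> X]eq_cvg do rewrite cLnorm1E.
Qed.

(** By linearity the error is almost everywhere [PF] of the remainder, so its norm lies between 0
    and [M] times the norm of the remainder. *)
Lemma perron_frobenius_cvg (e : nat -> edge E) : injective e ->
  ae_support mu phi (\bigcup_j bs_R B (e j)) ->
  cLnorm mu 1%:E (fun x => PF phi2 x - \sum_(j < N) pi (star (S (e j))) phi x ^+ 2)
    @[N --> \oo] --> 0%E.
Proof.
move=> ie supp; have [bPF _] := hPF.
have [M boundM] := bounded_operator_bound bPF.
have PFrest N : cLnorm mu 1%:E
    (fun x => PF phi2 x - \sum_(j < N) pi (star (S (e j))) phi x ^+ 2)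
    = cLnorm mu 1%:E (PF (rest e N)).
  have sumL := memL1_sum (index_enum 'I_N) (fun j => cutL (e j)).
  apply: cLnorm1_ae.
  - apply: cmeasurableB; first by case: (bounded_operator_mem bPF phi2L).
    suff [] : memLp mu 1%:E (fun x => \sum_(j < N) pi (star (S (e j))) phi x ^+ 2) by [].
    apply: memL1_sum => j; apply: memL1_sqr; exact: bounded_operator_mem.
  - by case: (bounded_operator_mem bPF (restL e N)).
  (* The remainder is written as -1 times the partial sum plus [phi2], to fit the linearity
     clause. *)
  have := bounded_operator_linear bPF (-1) sumL phi2L.
  apply: filterS2 (perron_frobenius_sum (fun j : 'I_N => e j)) => x /(_ I) <- /(_ I) + _.
  by under [X in PF X x]eq_fun do rewrite mulN1r addrC; move=> ->; rewrite mulN1r addrC.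
apply: (@squeeze_cvge _ _ _ _ (cst 0%E) _ (fun N => M%:E * cLnorm mu 1%:E (rest e N))%E).
- by apply: nearW => N; rewrite PFrest boundM// andbT Lnorm_ge0.
- exact: cvg_cst.
- by rewrite -[X in _ --> X](mule0 M%:E); apply: cvgeZl => //; exact: cvg_cLnorm_rest.
Qed.

End theorem_4_4.

Theorem theorem4p4 (R : realType) (E : digraph)
  (d : measure_display) (X : measurableType d) (mu : {measure set X -> \bar R})
  (B : branching_system E mu) (F : X -> X)
  (hF : nonsingular_branching_system B F)
  (A : cstar_algebra R) (P : vertex E -> A) (S : edge E -> A)
  (hA : graph_cstar P S)
  (pi : A -> (X -> R[i]) -> (X -> R[i]))
  (hpi : induced_representation B P S pi)
  (PF : (X -> R[i]) -> (X -> R[i]))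
  (hPF : perron_frobenius mu F PF)
  (phi : X -> R[i]) (hphi : memLp mu 2%:E phi) :
  [/\ (forall (N : nat) (e : 'I_N -> edge E), injective e ->
        ae_support mu phi (\bigcup_j bs_R B (e j)) ->
        PF (fun x => phi x ^+ 2)
          = (fun x => \sum_(j < N) pi (star (S (e j))) phi x ^+ 2) %[ae mu]),
      (forall e : nat -> edge E, injective e ->
        (\forall x \ae mu, complex.Im (phi x) = 0) ->
        ae_support mu phi (\bigcup_j bs_R B (e j)) ->
        cLnorm mu 1%:E (fun x => PF (fun y => phi y ^+ 2) x
                          - \sum_(j < N) pi (star (S (e j))) phi x ^+ 2)
          @[N --> \oo] --> 0%E) &
      (forall e : nat -> edge E, injective e ->
        ae_support mu phi (\bigcup_j bs_R B (e j)) ->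
        forall u v : X -> R,
        phi = (fun x => u x +i* v x) %[ae mu] ->
        memLp mu 2%:E (fun x => (u x * v x)%:C) ->
        cLnorm mu 1%:E (fun x => PF (fun y => phi y ^+ 2) x
                          - \sum_(j < N) pi (star (S (e j))) phi x ^+ 2)
          @[N --> \oo] --> 0%E)].
Proof.
split.
- by move=> N e ie supp; exact: (perron_frobenius_finite_support hF hpi hPF hphi ie supp).
- by move=> e ie _ supp; exact: (perron_frobenius_cvg hF hpi hPF hphi ie supp).
- by move=> e ie supp u v _ _; exact: (perron_frobenius_cvg hF hpi hPF hphi ie supp).
Qed.
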